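(* For all integers $n,p\ge 0$ and all complex numbers $a,d$ with $d\neq 0$, $$S_{p,(a,d)}(n)=d^{p}\sum_{k=0}^{p}k!\binom{n+1}{k+1}\,\mathcal{S}_{p}^{k}\!\left(\frac{a}{d}\right).$$
   Context: For non-negative integers $n,p$ and complex numbers $a,d$ with $d\ne 0$, $S_{p,(a,d)}(n)=\sum_{s=0}^{n}(a+sd)^{p}$ (with the convention $0^0=1$). For non-negative integers $n,i$ and complex $x$, the weighted Stirling numbers of the second kind are $\mathcal{S}_{n}^{i}(x)=\frac{1}{i!}\sum_{j=0}^{i}(-1)^{i-j}\binom{i}{j}(x+j)^{n}$ (again with $0^0=1$); equivalently, $\sum_{n\ge i}\mathcal{S}_{n}^{i}(x)\frac{z^{n}}{n!}=\frac{1}{i!}e^{xz}(e^{z}-1)^{i}$. *)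

(* Defs.v *)
(* The complex numbers are R[i] for R : realType. *)
From HB Require Import structures.
From mathcomp Require Import all_boot all_order all_algebra.
From mathcomp Require Import reals.
From mathcomp.real_closed Require Import complex.

Set Implicit Arguments.
Unset Strict Implicit.
Unset Printing Implicit Defensive.

Import Order.TTheory GRing.Theory Num.Theory.
Local Open Scope ring_scope.

(* The convention 0^0 = 1 holds for _ ^+ _ by expr0. *)
Definition power_sum (R : realType) (p : nat) (a d : R[i]) (n : nat) : R[i] :=
  \sum_(0 <= s < n.+1) (a + s%:R * d) ^+ p.

(* Lower index n and upper index i of S_n^i(x), in this order. *)
Definition wstirling2 (R : realType) (n i : nat) (x : R[i]) : R[i] :=
  (i`!%:R)^-1 *
  \sum_(0 <= j < i.+1) (-1) ^+ (i - j) * 'C(i, j)%:R * (x + j%:R) ^+ n.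

(* Main.v *)
(* The k-th forward difference of t |-> t^p at x is k! times the weighted
   Stirling number S_p^k(x), and it vanishes for k > p.  Newton's forward
   difference formula thus expands (a/d + s)^p in the binomials 'C(s, k) with
   k <= p; summing over s turns 'C(s, k) into 'C(n+1, k+1). *)
Require Import Defs.
From mathcomp Require Import all_boot all_order all_algebra.
From mathcomp Require Import reals.
From mathcomp.real_closed Require Import complex.
Import GRing.Theory Num.Theory.
Local Open Scope ring_scope.

(** The closed alternating sum is used instead of an iterated difference, so that it matches the sum
    in [wstirling2] term by term. *)
Definition fdiff {A : comNzRingType} (k : nat) (f : A -> A) (x : A) : A :=
  \sum_(0 <= j < k.+1) (-1) ^+ (k - j) * 'C(k, j)%:R * f (x + j%:R).

Lemma fdiff0 (A : comNzRingType) (f : A -> A) x : fdiff 0 f x = f x.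
Proof. by rewrite /fdiff big_nat1 bin0 expr0 !mul1r addr0. Qed.

Lemma fdiffS (A : comNzRingType) k (f : A -> A) x :
  fdiff k.+1 f x = fdiff k f (x + 1) - fdiff k f x.
Proof.
rewrite {1}/fdiff big_nat_recl // bin0 subn0 addr0.
under eq_bigr => j _ do rewrite binS subSS natrD mulrDr mulrDl.
rewrite big_split /= addrA addrC; congr (_ + _).
  by apply: eq_bigr => j _; rewrite -addrA nat1r.
(* The top term carries ['C(k, k.+1)], which is 0. Without it [j < k], so the truncated exponents do
   differ by one. *)
rewrite big_nat_recr //= bin_small // mulr0 mul0r addr0.
rewrite /fdiff big_nat_recl // bin0 subn0 addr0 opprD exprS mulN1r !mulNr.
congr (_ + _); rewrite -sumrN; apply: eq_big_nat => j /andP[_ ltjk].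
by rewrite -(subnSK ltjk) exprS mulN1r !mulNr.
Qed.

(** Puts the unit difference innermost, where it lowers the degree of a power. *)
Lemma fdiff_shift_sub (A : comNzRingType) k (f : A -> A) x :
  fdiff k.+1 f x = fdiff k (fun y => f (y + 1) - f y) x.
Proof.
rewrite fdiffS /fdiff -sumrB; apply: eq_bigr => j _.
by rewrite mulrBr (addrAC x).
Qed.

Lemma fdiff_expr_eq0 (A : comNzRingType) k p (x : A) :
  (p < k)%N -> fdiff k (fun y => y ^+ p) x = 0.
Proof.
elim: k p => // k IHk p ltpk; rewrite fdiff_shift_sub.
transitivity (\sum_(i < p) 'C(p, i)%:R * fdiff k (fun y => y ^+ i) x).
  rewrite /fdiff; under [RHS]eq_bigr do rewrite mulr_sumr.
  rewrite exchange_big /=; apply: eq_bigr => j _.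
  (* The leading power cancels in [(y + 1) ^+ p - y ^+ p], leaving exponents below [p] for the
     induction. *)
  rewrite exprD1n big_ord_recr /= binn mulr1n addrK.
  rewrite mulr_sumr; apply: eq_bigr => i _.
  by rewrite mulr_natl -mulrnAr.
by rewrite big1 // => i _; rewrite IHk ?mulr0 // (leq_trans (ltn_ord i)).
Qed.

Lemma newton_forward (A : comNzRingType) p (f : A -> A) s x :
  (forall y, fdiff p.+1 f y = 0) ->
  f (x + s%:R) = \sum_(0 <= k < p.+1) 'C(s, k)%:R * fdiff k f x.
Proof.
move=> fp0; elim: s x => [|s IHs] x.
  rewrite big_nat_recl // bin0 mul1r fdiff0 addr0 big1 ?addr0 // => k _.
  by rewrite mul0r.
(* Expand at [x + 1], then return to [x] by [fdiffS]; Pascal's rule merges the two sums. *)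
rewrite -nat1r addrA IHs.
under eq_bigr => k _ do
  rewrite -[fdiff _ _ (x + 1)](subrK (fdiff k f x)) -fdiffS mulrDr.
(* The shifted sum overshoots to order [p.+1], where [fp0] applies. *)
rewrite big_split /= big_nat_recr //= fp0 mulr0 addr0.
rewrite [X in _ + X]big_nat_recl // [RHS]big_nat_recl // !bin0 addrCA.
by congr (_ + _); rewrite -big_split; apply: eq_bigr => k _;
   rewrite binS natrD mulrDl addrC.
Qed.

Lemma sum_newton_forward (A : comNzRingType) p (f : A -> A) m x :
  (forall y, fdiff p.+1 f y = 0) ->
  \sum_(0 <= s < m) f (x + s%:R) =
  \sum_(0 <= k < p.+1) 'C(m, k.+1)%:R * fdiff k f x.
Proof.
move=> fp0; elim: m => [|m IHm].
  by rewrite big_nil big1 // => k _; rewrite mul0r.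
rewrite big_nat_recr //= IHm (newton_forward _ _ _ _ _ fp0) -big_split.
by apply: eq_bigr => k _; rewrite binS natrD mulrDl.
Qed.

Lemma fact_wstirling2 (R : realType) p k (x : R[i]) :
  k`!%:R * wstirling2 p k x = fdiff k (fun y => y ^+ p) x.
Proof. by rewrite mulVKf // pnatr_eq0 -lt0n fact_gt0. Qed.

Theorem theorem1 (R : realType) (n p : nat) (a d : R[i]) (hd : d != 0) :
  power_sum p a d n =
  d ^+ p * \sum_(0 <= k < p.+1)
             k`!%:R * 'C(n.+1, k.+1)%:R * wstirling2 p k (a / d).
Proof.
under [in RHS]eq_bigr do rewrite mulrAC fact_wstirling2 mulrC.
rewrite -(sum_newton_forward _ p (fun y => y ^+ p)); last first.
  by move=> y; apply: fdiff_expr_eq0.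
(* Termwise, [d ^+ p] is absorbed into the power, and [hd] gives [d * (a / d) = a]. *)
rewrite mulr_sumr; apply: eq_bigr => s _.
by rewrite -exprMn mulrDr mulrCA divff // mulr1 mulrC [d * _]mulrC.
Qed.
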